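(* For each integer $k\geq 1$ and real $\epsilon>0$ there are $N=N(\epsilon,k)$ and $n_0=n_0(\epsilon,k)$ such that for every $k$-edge stable graph $G$ with at least $n_0$ vertices there is a partition of the vertex set of $G$ into disjoint pieces $A_0,\dots,A_{\ell-1}$ with $\ell\leq N$ such that: (a) the partition is equitable, i.e. for all $i,j<\ell$, $|A_i|$ and $|A_j|$ differ by at most $1$; (b) each $A_i$ is $\epsilon$-excellent; (c) every pair $(A_i,A_j)$ is $\epsilon$-uniform; (d) if $\epsilon<\frac{1}{2^t}$, where $t=2^{k+2}-2$, then $N$ may be taken with $N\leq 4\left(\frac{8}{\epsilon}\right)^{t-2}$.
   Context: A graph is a finite set of vertices with a symmetric irreflexive edge relation $R$; a subset $A\subseteq G$ of vertices is regarded as the induced subgraph, and $|A|$ is its number of vertices. For a formula $\varphi$ write $\varphi^1=\varphi$ and $\varphi^0=\neg\varphi$. A graph $G$ is $k$-edge stable if there do not exist distinct vertices $a_1,\dots,a_k,b_1,\dots,b_k$ of $G$ such that $R(a_i,b_j)$ holds iff $i<j$. (The number $t=2^{k+2}-2$ is the ''tree bound'': a $k$-edge stable graph contains no full special tree of height $t$.) A set $A\subseteq G$ is $\epsilon$-good if for every vertex $b\in G$, either $|\{a\in A: R(b,a)\}|<\epsilon|A|$ or $|\{a\in A:\neg R(b,a)\}|<\epsilon|A|$; in that case $\mathbf{t}(b,A)\in\{0,1\}$ denotes a truth value such that for all but fewer than $\epsilon|A|$ elements $a\in A$, $R(b,a)^{\mathbf{t}(b,A)}$ holds. A set $A\subseteq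 G$ is $\epsilon$-excellent if for every $\epsilon$-good $B\subseteq G$, either $|\{a\in A:\mathbf{t}(a,B)=1\}|<\epsilon|A|$ or $|\{a\in A:\mathbf{t}(a,B)=0\}|<\epsilon|A|$. A pair $(A,B)$ of vertex sets is $\epsilon$-uniform if there is a truth value $\mathbf{t}\in\{0,1\}$ such that for all but fewer than $\epsilon|A|$ elements $a\in A$, for all but fewer than $\epsilon|B|$ elements $b\in B$, $R(a,b)^{\mathbf{t}}$ holds.
   Formalization: The value ε = 1/2 is excluded, because the claim fails there for k ≥ 3: in the join of two perfect matchings on 2^j vertices each, no nonempty set of even size is 1/2-excellent, so the pieces would have to be singletons. *)

(* Defs.v *)
From mathcomp Require Import all_boot all_order all_algebra.
From mathcomp Require Import reals.

Set Implicit Arguments.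
Unset Strict Implicit.
Unset Printing Implicit Defensive.

Import Order.TTheory GRing.Theory Num.Theory.

Local Open Scope ring_scope.

Definition edge_stable (k : nat) (T : finType) (E : rel T) : Prop :=
  ~ exists a b : 'I_k -> T,
      [/\ injective a, injective b, (forall i j, a i <> b j) &
          forall i j : 'I_k, E (a i) (b j) = (i < j)%N].

Definition tree_bound (k : nat) : nat := (2 ^ (k + 2) - 2)%N.

Section Excellence.
Variables (R : realType) (eps : R) (T : finType) (E : rel T).

Definition all_but_few (A : {set T}) (P : pred T) : bool :=
  #|[set a in A | ~~ P a]|%:R < eps * #|A|%:R.

Definition good (A : {set T}) : Prop :=
  forall b : T, #|[set a in A | E b a]|%:R < eps * #|A|%:R \/
                #|[set a in A | ~~ E b a]|%:R < eps * #|A|%:R.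

(* [truth_value b A v] says that v is a legitimate value of t(b, A). For good A
   such a v exists, and it is unique as soon as eps <= 1/2. *)
Definition truth_value (b : T) (A : {set T}) (v : bool) : Prop :=
  all_but_few A (fun a => E b a == v).

(* When eps > 1/2 the value t(a, B) need not be determined by a and B, so the
   condition is required for every choice of the function t(-, B). *)
Definition excellent (A : {set T}) : Prop :=
  forall B : {set T}, good B ->
  forall t : T -> bool, (forall a, truth_value a B (t a)) ->
    #|[set a in A | t a == true]|%:R < eps * #|A|%:R \/
    #|[set a in A | t a == false]|%:R < eps * #|A|%:R.

Definition uniform (A B : {set T}) : Prop :=
  exists v : bool,
    all_but_few A (fun a => all_but_few B (fun b => E a b == v)).

End Excellence.

(* Main.v *)
Require Import Defs.
From mathcomp Require Import all_boot all_order all_algebra.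
From mathcomp Require Import reals sequences analysis.exp.
From mathcomp Require Import zify ring lra.

(** For [eps > 1/2] the one-piece partition works, so let [eps < 1/2]. Suppose
    a full binary tree has its nodes labelled by eps-good sets [B] and its
    leaves by vertices whose values [t(-, B)] follow the branches. Replacing
    each [B], from the root down, by one well-chosen vertex of [B] keeps a
    fraction [1 - eps] of the leaves below it; at height [h] at least
    [(2 (1 - eps)) ^ h] leaves survive, and by a Sauer-Shelah count they contain
    a full tree of the graph itself, of height [3 * 2 ^ k - 3]. Such a tree
    yields a half-graph of length [k], against stability. Hence the trees of
    good sets have bounded height, with two consequences. Splitting a set along
    good sets stops at a large subset that no good set cuts in a proportion
    above [zeta = eps / 16]; and there are only polynomially many functions
    [t(-, B)], so that such a subset contains one of any prescribed linear size
    with almost the same property. Such subsets of equal size are removed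
    greedily and the few remaining vertices are spread evenly over them.
    Uniformity of pairs follows from excellence. *)

Set Implicit Arguments.
Unset Strict Implicit.
Unset Printing Implicit Defensive.

Import Order.TTheory GRing.Theory Num.Theory.

(** * Binary trees of a relation *)

Section SetComplements.
Variable T : finType.
Implicit Types (S X : {set T}).

Lemma setIU_sub S X1 X2 :
  X1 \subset S -> X2 \subset ~: S -> (X1 :|: X2) :&: S = X1.
Proof.
move=> sX1 sX2; rewrite setIUl (setIidPl sX1) disjoint_setI0 ?setU0 //.
by rewrite disjoints_subset.
Qed.

Lemma setDU_sub S X1 X2 :
  X1 \subset S -> X2 \subset ~: S -> (X1 :|: X2) :\: S = X2.
Proof. by move=> sX1 sX2; rewrite setDE setUC setIU_sub ?setCK. Qed.

Lemma cardsU_sub S X1 X2 :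
  X1 \subset S -> X2 \subset ~: S -> #|X1 :|: X2| = #|X1| + #|X2|.
Proof. by move=> sX1 sX2; rewrite -(cardsID S) setIU_sub ?setDU_sub. Qed.

Lemma exists_subset_card X m :
  m <= #|X| -> exists2 Z : {set T}, Z \subset X & #|Z| = m.
Proof.
case/card_geqP=> s [us cs sX]; exists [set x in s].
  by apply/subsetP=> x; rewrite inE; apply: sX.
by rewrite cardsE (card_uniqP us).
Qed.

End SetComplements.

Lemma sum_binS n d :
  \sum_(i < d.+1) 'C(n.+1, i) =
  \sum_(i < d.+1) 'C(n, i) + \sum_(i < d) 'C(n, i).
Proof.
rewrite big_ord_recl [in RHS]big_ord_recl !bin0 -addnA -big_split /=.
by congr (_ + _); apply: eq_bigr => i _; rewrite binS.
Qed.

Lemma leq_bin_exp n i : 'C(n, i) <= n ^ i.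
Proof.
elim: i => [|i IH]; first by rewrite bin0.
by rewrite expnS; have := mul_bin_left n i; nia.
Qed.

Lemma leq_sum_bin_exp n d : \sum_(i < d) 'C(n, i) <= n.+1 ^ d.
Proof.
rewrite -add1n expnDn big_ord_recr /=; apply: leq_trans (leq_addr _ _).
apply: leq_sum => i _; rewrite exp1n mul1n (leq_trans (leq_bin_exp n i)) //.
by rewrite leq_pmull // bin_gt0 ltnW.
Qed.

Section Trees.
Variables (T I : finType) (r : T -> I -> bool).
Implicit Types (X Z : {set T}) (Y C : {set I}) (P : {set T} -> Prop).

Definition lnbhd i : {set T} := [set x | r x i].

Definition rnbhd x : {set I} := [set i | r x i].

Fixpoint split_tree P Y d X : Prop :=
  if d is d'.+1 then
    exists i, [/\ i \in Y, split_tree P Y d' (X :&: lnbhd i)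
                & split_tree P Y d' (X :\: lnbhd i)]
  else P X.

Definition full_tree : {set I} -> nat -> {set T} -> Prop :=
  split_tree (fun leaf => leaf != set0).

Definition separating_tree : {set I} -> nat -> {set T} -> Prop :=
  split_tree (fun leaf => #|leaf| <= 1).

Lemma split_tree_mono P P' Y Y' d X X' : Y \subset Y' ->
  (forall Z, P (X :&: Z) -> P' (X' :&: Z)) ->
  split_tree P Y d X -> split_tree P' Y' d X'.
Proof.
move=> sY; elim: d X X' => [|d IH] X X' hP /=.
  by have := hP setT; rewrite !setIT.
case=> i [iY tl tr]; exists i; split; first exact: (subsetP sY).
  by apply: IH tl => Z; rewrite -!setIA; apply: hP.
by apply: IH tr => Z; rewrite !setDE -!setIA; apply: hP.
Qed.

Lemma full_treeS Y Y' d X X' :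
  Y \subset Y' -> X \subset X' -> full_tree Y d X -> full_tree Y' d X'.
Proof.
move=> sY sX; apply: split_tree_mono => // Z; apply: contraNneq => X'Z.
by rewrite -subset0 -X'Z setSI.
Qed.

Lemma separating_treeS Y d X X' :
  X' \subset X -> separating_tree Y d X -> separating_tree Y d X'.
Proof.
move=> sX; apply: split_tree_mono => // Z; apply: leq_trans.
by rewrite subset_leq_card // setSI.
Qed.

Lemma full_tree_neq0 Y d X : full_tree Y d X -> X != set0.
Proof.
elim: d X => [|d IH] X //= [i [_ /IH /set0Pn [x] + _]].
by rewrite inE => /andP [xX _]; apply/set0Pn; exists x.
Qed.

Lemma full_treeD_le1 Y d X Z :
  #|Z| <= 1 -> full_tree Y d.+1 X -> full_tree Y d (X :\: Z).
Proof.
move=> /card_le1_eqP Z1 [i [_ tl tr]].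
have [Zi|/pred0Pn [z /andP [zZ zi]]] := boolP [disjoint Z & lnbhd i].
  apply: full_treeS tl => //; apply/subsetP=> x /setIP [xX xi].
  by rewrite inE xX (disjointFl Zi xi).
apply: full_treeS tr => //; apply/subsetP=> x /setDP [xX xi].
by rewrite inE xX andbT; apply: contra xi => xZ; rewrite (Z1 z x).
Qed.

Lemma full_tree_separating Y d X : full_tree Y d X ->
  exists X', [/\ X' \subset X, #|X'| = 2 ^ d & separating_tree Y d X'].
Proof.
elim: d X => [|d IH] X /=.
  case/set0Pn=> x xX; exists [set x].
  by rewrite sub1set /separating_tree /= cards1.
case=> i [iY /IH [X1 [+ cX1 tX1]] /IH [X2 [+ cX2 tX2]]].
rewrite subsetI setDE subsetI => /andP [sX1 sN1] /andP [sX2 sN2].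
exists (X1 :|: X2); split; first by rewrite subUset sX1.
  by rewrite (cardsU_sub sN1) // cX1 cX2 expnS mul2n addnn.
by exists i; rewrite setIU_sub ?setDU_sub.
Qed.

Lemma separating_tree_seq (s : seq I) X :
  {in X &, forall x y, {in s, r x =1 r y} -> x = y} ->
  separating_tree [set: I] (size s) X.
Proof.
elim: s X => [|i s IH] X sepX; first by apply/card_le1_eqP=> x y *; apply: sepX.
have sep_side (b : bool) (Z : {set T}) :
    {subset Z <= [pred x in X | r x i == b]} -> separating_tree setT (size s) Z.
  move=> sZ; apply: IH => x y /sZ /andP [xX /eqP rx] /sZ /andP [yX /eqP ry] xy.
  by apply: sepX => // j /predU1P [->|/xy //]; rewrite rx.
exists i; split; first by rewrite inE.
  by apply: (sep_side true) => x; rewrite !inE eqb_id.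
by apply: (sep_side false) => x; rewrite !inE eqbF_neg andbC.
Qed.

(* The Sauer-Shelah bound for trees. *)
Lemma full_tree_of_separating Y h d X : separating_tree Y h X ->
  \sum_(i < d) 'C(h, i) < #|X| -> full_tree Y d X.
Proof.
elim: h d X => [|h IH] [|d] X.
1,3: by rewrite big_ord0 card_gt0.
  move=> X1; rewrite big_ord_recl bin0 ltnNge.
  by rewrite (leq_trans X1) // leq_addr.
case=> i [iY tl tr]; rewrite sum_binS -(cardsID (lnbhd i) X) => ltX.
have [ltl|lel] := ltnP (\sum_(j < d.+1) 'C(h, j)) #|X :&: lnbhd i|.
  exact: full_treeS (subsetIl X (lnbhd i)) (IH d.+1 _ tl ltl).
have [ltr|ler] := ltnP (\sum_(j < d.+1) 'C(h, j)) #|X :\: lnbhd i|.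
  exact: full_treeS (subsetDl X (lnbhd i)) (IH d.+1 _ tr ltr).
by exists i; split=> //; apply: IH => //; lia.
Qed.

Lemma full_tree_Ramsey Y C p q X : full_tree Y (p + q) X ->
  full_tree (Y :&: C) p X \/ full_tree (Y :\: C) q.+1 X.
Proof.
have [d] := ubnP (p + q); elim: d p q X => // d IH [|p] q X.
  by move=> _ /full_tree_neq0; left.
rewrite addSn ltnS => led [i [iY tl tr]].
have sI : X :&: lnbhd i \subset X by apply: subsetIl.
have sD : X :\: lnbhd i \subset X by apply: subsetDl.
have [iC|niC] := boolP (i \in C).
  have [tlC|tlC] := IH p q _ led tl; last by right; apply: full_treeS tlC.
  have [trC|trC] := IH p q _ led tr; last by right; apply: full_treeS trC.
  by left; exists i; rewrite inE iY iC.
case: q led tl tr => [|q] led tl tr.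
  right; exists i; rewrite inE niC iY.
  by split; [| apply: full_tree_neq0 tl | apply: full_tree_neq0 tr].
rewrite -addSnnS in led tl tr.
have [tlC|tlC] := IH p.+1 q _ led tl; first by left; apply: full_treeS tlC.
have [trC|trC] := IH p.+1 q _ led tr; first by left; apply: full_treeS trC.
by right; exists i; rewrite inE niC iY.
Qed.

Lemma full_tree2_card_nodes C X : full_tree C 2 X -> 1 < #|C|.
Proof.
case=> i [iC [j [jC _ /set0Pn [x xij]]] _]; move: xij.
rewrite !inE => /and3P [rxj _ rxi]; rewrite ltnNge.
apply/negP=> /card_le1_eqP/(_ i j iC jC) ij.
by rewrite ij rxi in rxj.
Qed.

Lemma full_tree_nodesD_le1 Y C d X :
  #|C| <= 1 -> full_tree Y d.+1 X -> full_tree (Y :\: C) d X.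
Proof.
move=> C1; rewrite -addn1 => /(full_tree_Ramsey (~: C)) [|t2].
  by rewrite -setDE.
have := full_tree2_card_nodes t2; rewrite ltnNge (leq_trans _ C1) //.
by rewrite subset_leq_card // setDE setCK subsetIr.
Qed.

End Trees.

(** * Half-graphs *)

Definition half_graph_height n := 3 * 2 ^ n - 3.

Section HalfGraphs.
Variables (T I : finType) (r same : T -> I -> bool).
Implicit Types (X : {set T}) (Y : {set I}).

(* [same x i] says that the leaf [x] and the node [i] are the same vertex. *)
Definition half_graph n X Y : Prop :=
  exists (a : nat -> T) (b : nat -> I),
    [/\ forall i, i < n -> a i \in X, forall j, j < n -> b j \in Y,
        forall i j, i < n -> j < n -> ~~ same (a i) (b j)
      & forall i j, i < n -> j < n -> r (a i) (b j) = (i < j)].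

Lemma half_graph_full_tree n X Y :
  half_graph (2 ^ n) X Y -> full_tree r Y n X.
Proof.
elim: n X => [|n IH] X [a [b [aX bY sab rab]]].
  by apply/set0Pn; exists (a 0); apply: aX.
have [lt lt_mid ltD] : [/\ forall i, i < 2 ^ n -> i < 2 ^ n.+1,
    2 ^ n < 2 ^ n.+1 & forall i, i < 2 ^ n -> 2 ^ n + i < 2 ^ n.+1].
  by have := expn_gt0 2 n; rewrite expnS; split=> *; lia.
exists (b (2 ^ n)); split; first exact: bY.
  apply: IH; exists a, b.
  split=> [i ltin|j /lt|i j /lt ltin /lt|i j /lt ltin /lt].
  - by rewrite !inE aX ?rab //; apply: lt.
  - exact: bY.
  - exact: sab.
  - exact: rab.
apply: IH; exists (fun i => a (2 ^ n + i)), (fun j => b (2 ^ n + j)).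
split=> [i /ltD ltin|j /ltD|i j /ltD ltin /ltD|i j /ltD ltin /ltD ltjn].
- by rewrite !inE aX // rab // -ltnNge ltnS leq_addr.
- exact: bY.
- exact: sab.
- by rewrite rab // ltn_add2l.
Qed.

Lemma half_graph_cons n X Y x i :
  x \in X -> i \in Y -> ~~ r x i -> ~~ same x i ->
  half_graph n (X :\: lnbhd r i :\: lnbhd same i)
               (Y :&: rnbhd r x :\: rnbhd same x) ->
  half_graph n.+1 X Y.
Proof.
move=> xX iY rxi sxi [a [b [aX bY sab rab]]].
exists (fun p => if p is p'.+1 then a p' else x).
exists (fun q => if q is q'.+1 then b q' else i).
split=> [[|p] // /aX|[|q] // /bY|[|p] [|q] //= ltp ltq|[|p] [|q] //= ltp ltq].
- by rewrite !inE => /and3P [].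
- by rewrite !inE => /and3P [].
- by have := bY q ltq; rewrite !inE => /and3P [].
- by have := aX p ltp; rewrite !inE => /and3P [].
- exact: sab.
- exact: negbTE.
- by have := bY q ltq; rewrite !inE => /and3P [].
- by have := aX p ltp; rewrite !inE => /and3P [_ /negbTE].
- exact: rab.
Qed.

Hypotheses (same_irr : forall x i, same x i -> ~~ r x i)
  (same_left : forall i, #|lnbhd same i| <= 1)
  (same_right : forall x, #|rnbhd same x| <= 1).

Lemma half_graph_rcons n X Y x i :
  x \in X -> i \in Y -> ~~ r x i -> ~~ same x i ->
  half_graph n (X :&: lnbhd r i) (Y :\: rnbhd r x :\: rnbhd same x) ->
  half_graph n.+1 X Y.
Proof.
move=> xX iY rxi sxi [a [b [aX bY sab rab]]].
exists (fun p => if p < n then a p else x).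
exists (fun q => if q < n then b q else i).
split=> [p _|q _|p q|p q].
- by case: ifP => // /aX; rewrite !inE => /andP [].
- by case: ifP => // /bY; rewrite !inE => /and3P [].
- case: ifP => ltp; case: ifP => ltq _ _ //; first exact: sab.
    have := aX p ltp; rewrite !inE => /andP [_]; apply: contraL.
    exact: same_irr.
  by have := bY q ltq; rewrite !inE => /and3P [].
- case: ifP => ltp; case: ifP => ltq lep leq; first exact: rab.
  + by have := aX p ltp; rewrite !inE => /andP [_ ->]; lia.
  + have := bY q ltq; rewrite !inE => /and3P [_ /negbTE -> _]; lia.
  + rewrite (negbTE rxi); lia.
Qed.

Lemma half_graphS n X X' Y Y' : X \subset X' -> Y \subset Y' ->
  half_graph n X Y -> half_graph n X' Y'.
Proof.
move=> sX sY [a [b [aX bY sab rab]]]; exists a, b; split=> // i ltin.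
  exact: (subsetP sX) (aX i ltin).
exact: (subsetP sY) (bY i ltin).
Qed.

(* One step costs 2d + 3 levels to go from height d: one for the root, one to
   drop the leaf identified with it, one to drop the node identified with the
   chosen leaf x, and 2d to find below them either d levels of nodes related to
   x, or d + 1 levels of nodes unrelated to x. *)
Lemma full_tree_half_graph (i0 : I) n X Y :
  full_tree r Y (half_graph_height n) X -> half_graph n X Y.
Proof.
elim: n X Y => [|n IH] X Y.
  by case/full_tree_neq0/set0Pn => x _; exists (fun=> x), (fun=> i0).
set d := half_graph_height n in IH *.
have -> : half_graph_height n.+1 = (d + d).+1.+2.
  by rewrite /d /half_graph_height expnS; have := expn_gt0 2 n; lia.
case=> i [iY _ tD].
have := @full_treeD_le1 _ _ r Y (d + d).+1 _ _ (same_left i) tD.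
set X' := _ :\: lnbhd same i => tX'.
have /set0Pn [x xX'] := full_tree_neq0 tX'.
have /and3P [sxi rxi xX] : [&& ~~ same x i, ~~ r x i & x \in X].
  by move: xX'; rewrite !inE.
have sX' : X' \subset X := subset_trans (subsetDl _ _) (subsetDl _ _).
case: (full_tree_Ramsey (rnbhd r x) (full_tree_nodesD_le1 (same_right x) tX')).
  move/IH/(half_graphS (subxx _)) => hg; apply: (half_graph_cons xX iY) => //.
  by apply: hg; rewrite setIDAC.
case=> j [+ + _]; rewrite !inE => /and3P [rxj sxj jY] /IH hg.
apply: (half_graph_rcons xX jY) => //.
apply: half_graphS hg; first exact: setSI.
by rewrite setDDl setUC -setDDl.
Qed.

End HalfGraphs.

Lemma half_graph_flip (T I : finType) (r same : T -> I -> bool) n X Y :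
  half_graph r same n X Y ->
  half_graph (fun i x => r x i) (fun i x => same x i) n Y X.
Proof.
case=> a [b [aX bY sab rab]].
exists (fun p => b (n.-1 - p)), (fun q => a (n.-1 - q)).
split=> [p ltp|q ltq|p q ltp ltq|p q ltp ltq].
- by apply: bY; lia.
- by apply: aX; lia.
- by apply: sab; lia.
- by rewrite rab; lia.
Qed.

Lemma edge_stable_half_graph (T : finType) (E : rel T) k X Y :
  edge_stable k E -> ~ half_graph E eq_op k X Y.
Proof.
move=> stE [a [b [_ _ ab Eab]]]; apply: stE.
have injective_ord (f : nat -> T) :
    (forall i j, i < j -> j < k -> f i <> f j) ->
    injective (fun i : 'I_k => f i).
  move=> ltf i j fij; apply: val_inj => /=.
  case: (ltngtP i j) => // /ltf.
    by case/(_ (ltn_ord j)).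
  by case/(_ (ltn_ord i)).
exists (fun i : 'I_k => a i), (fun i : 'I_k => b i); split.
- apply: injective_ord => i j ltij ltjk aij.
  by have := Eab i j (ltn_trans ltij ltjk) ltjk; rewrite aij Eab // ltnn ltij.
- apply: injective_ord => i j ltij ltjk bij.
  have ltik := ltn_trans ltij ltjk.
  by have := Eab i j ltik ltjk; rewrite -bij Eab // ltnn ltij.
- by move=> i j; apply/eqP; apply: ab.
- by move=> i j; apply: Eab.
Qed.

Lemma stable_no_full_tree (T : finType) (E : rel T) k X Y :
  irreflexive E -> edge_stable k E ->
  ~ full_tree E Y (half_graph_height k) X.
Proof.
move=> irrE stE tX.
have /set0Pn [x0 _] := full_tree_neq0 tX; move: tX.
move/(full_tree_half_graph (same := eq_op)) => hg.
apply: (edge_stable_half_graph stE) (hg _ _ _ x0) => [x i /eqP ->|i|x].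
- by rewrite irrE.
- by apply/card_le1_eqP=> x y; rewrite !inE => /eqP -> /eqP ->.
- by apply/card_le1_eqP=> i j; rewrite !inE => /eqP <- /eqP <-.
Qed.

(** * Families of sets *)

Definition mem_rel (T : finType) (x : T) (S : {set T}) : bool := x \in S.

Lemma lnbhd_mem (T : finType) (S : {set T}) : lnbhd (@mem_rel T) S = S.
Proof. by apply/setP=> x; rewrite inE. Qed.

(* A large family has a full tree with vertices as nodes and sets as leaves; the
   half-graph in it yields a full tree with the roles exchanged. *)
Lemma card_no_full_tree (T : finType) (F : {set {set T}}) h :
  (forall X, ~ full_tree (@mem_rel T) F h X) ->
  #|F| <= #|T|.+1 ^ half_graph_height (2 ^ h).
Proof.
move=> noF; have sepF : separating_tree (fun S x => mem_rel x S) setT #|T| F.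
  rewrite cardE; apply: separating_tree_seq => S S' _ _ SS'; apply/setP=> x.
  by apply: SS'; rewrite mem_enum.
have [T0|/card_gt0P [x0 _]] := posnP #|T|.
  by rewrite T0 in sepF; apply: leq_trans sepF _; rewrite expn_gt0.
rewrite leqNgt; apply/negP=> largeF; apply: (noF [set: T]).
apply: (half_graph_full_tree (same := fun _ _ => false)).
apply: (@half_graph_flip _ _ (fun S x => mem_rel x S) (fun _ _ => false)).
apply: (full_tree_half_graph _ _ _ x0) => // [x|S|].
1,2: by apply/card_le1_eqP=> ? ?; rewrite inE.
apply: (full_tree_of_separating sepF).
exact: leq_ltn_trans (leq_sum_bin_exp _ _) _.
Qed.

Local Open Scope ring_scope.

(** * Estimates and averages *)

Lemma Bernoulli_le (R : realDomainType) (u : R) n :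
  -1 <= u -> 1 + n%:R * u <= (1 + u) ^+ n.
Proof.
move=> u1; elim: n => [|n IH]; first by rewrite mul0r addr0 expr0.
rewrite exprS; apply: le_trans (ler_wpM2l _ IH); last by lra.
rewrite -natr1; have : 0 <= n%:R * u ^+ 2 by rewrite mulr_ge0 ?sqr_ge0.
by nra.
Qed.

Lemma exp1D_le_exp2 (R : realType) (u : R) n c :
  -1 <= u -> 2 * (n%:R * u) <= c%:R -> (1 + u) ^+ n <= 2 ^+ c.
Proof.
move=> u1 le_c; apply: (@le_trans _ _ (expR (n%:R * u))).
  by rewrite expRM_natl lerXn2r ?nnegrE ?expR_ge0 ?expR_ge1Dx //; lra.
have half : expR (2^-1 : R) <= 2.
  rewrite -[2^-1]opprK expRN -[leRHS]invrK.
  rewrite lef_pV2 ?posrE ?expR_gt0 ?invr_gt0 //.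
  by apply: le_trans (expR_ge1Dx _); lra.
apply: (@le_trans _ _ (expR (c%:R * 2^-1))); first by rewrite ler_expR; lra.
by rewrite expRM_natl lerXn2r ?nnegrE ?expR_ge0.
Qed.

Lemma poly_lt_exp (R : realType) (c y : R) D : 0 <= c -> 1 < y ->
  exists m0 : nat, forall m, (m0 <= m)%N -> c * m.+1%:R ^+ D < y ^+ m.
Proof.
move=> c0 y1; have v0 : 0 < ln y by rewrite ln_gt0.
pose q := ln y ^+ D.+1 / D.+1`!%:R.
have q0 : 0 < q by rewrite divr_gt0 ?exprn_gt0 // ltr0n fact_gt0.
pose K := c * 2 ^+ D / q.
exists (Num.truncn K).+1 => m ltKm.
have Km : K < m%:R by rewrite (lt_le_trans (truncnS_gt K)) ?ler_nat.
have m0 : 0 < m%:R :> R by rewrite ltr0n (leq_trans _ ltKm).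
have y0 : 0 < y by lra.
rewrite -[y in ltRHS]lnK ?posrE // -expRM_natl.
have mv0 : 0 <= m%:R * ln y by rewrite mulr_ge0 // ltW.
apply: lt_le_trans (expR_ge1Dxn D mv0).
apply: (@lt_trans _ _ (m%:R * q * m%:R ^+ D)).
  apply: (@le_lt_trans _ _ (c * (2 * m%:R) ^+ D)).
    rewrite ler_wpM2l // lerXn2r ?nnegrE ?mulr_ge0 // -natrM ler_nat.
    by move: ltKm; case: (m) => // m' _; lia.
  by rewrite exprMn mulrA ltr_pM2r ?exprn_gt0 // -ltr_pdivrMr.
by rewrite mulrAC -exprS exprMn /q mulrA ltrDr.
Qed.

Lemma truncn_mulr_unbounded (R : realType) (s : R) (m0 : nat) : 0 < s ->
  exists n0 : nat, forall n, (n0 <= n)%N -> (m0 <= Num.truncn (s * n%:R))%N.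
Proof.
move=> s0; exists (Num.truncn (m0%:R / s)).+1 => n len.
rewrite truncn_ge_nat ?mulr_ge0 ?(ltW s0) // mulrC -ler_pdivrMr //.
by apply: ltW (lt_le_trans (truncnS_gt _) _); rewrite ler_nat.
Qed.

Lemma poly_lt_exp_truncn (R : realType) (s y : R) D : 0 < s -> 1 < y ->
  exists n0 : nat, forall n, (n0 <= n)%N ->
    n.+1%:R ^+ D < y ^+ Num.truncn (s * n%:R).
Proof.
move=> s0 y1; have si0 : 0 <= s^-1 by rewrite invr_ge0 ltW.
have [|m0 hm0] := @poly_lt_exp _ ((s^-1 + 1) ^+ D) y D _ y1.
  by rewrite exprn_ge0 // addr_ge0.
have [n0 hn0] := truncn_mulr_unbounded m0 s0; exists n0 => n /hn0 /hm0.
set m := Num.truncn _; apply: le_lt_trans; rewrite -exprMn.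
have nm : n%:R <= s^-1 * m.+1%:R.
  by rewrite mulrC ler_pdivlMr // mulrC ltW // truncnS_gt.
rewrite lerXn2r ?nnegrE ?mulr_ge0 ?addr_ge0 //.
by rewrite mulrDl mul1r -[n.+1%:R]natr1 lerD // ler1n.
Qed.

Lemma exists_le_mean (R : realFieldType) (I : finType) (B : {set I})
    (f : I -> R) (c : R) :
  B != set0 -> \sum_(i in B) f i <= c * #|B|%:R ->
  exists2 i, i \in B & f i <= c.
Proof.
move=> /set0Pn [i0 i0B] le_sum.
have [/exists_inP [i]|/exists_inPn no_le] := boolP [exists i in B, f i <= c].
  by exists i.
suff : c * #|B|%:R < \sum_(i in B) f i by rewrite ltNge le_sum.
rewrite mulr_natr -sumr_const; apply: ltr_sum => [|i iB]; last first.
  by rewrite ltNge no_le.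
by apply/hasP; exists i0; rewrite ?mem_index_enum.
Qed.

Lemma sum_card_exchange (I J : finType) (A : {set I}) (B : {set J})
    (P : I -> J -> bool) :
  (\sum_(i in A) #|[set j in B | P i j]| =
   \sum_(j in B) #|[set i in A | P i j]|)%N.
Proof.
transitivity (\sum_(i in A) \sum_(j in B | P i j) 1)%N.
  by apply: eq_bigr => i _; rewrite sum1dep_card.
rewrite (exchange_big_dep (mem B)) /=; last by move=> ? ? _ /andP [].
apply: eq_bigr => j jB; rewrite sum1dep_card; apply: eq_card => i.
by rewrite !inE jB.
Qed.

(** * Sets that a family does not cut *)

Section Indivisible.
Variables (R : realFieldType) (T : finType) (F : {set {set T}}).
Implicit Types (eps zeta delta : R) (A W S : {set T}).

Definition indivisible zeta A : Prop :=
  forall S, S \in F ->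
    #|A :&: S|%:R < zeta * #|A|%:R \/ #|A :\: S|%:R < zeta * #|A|%:R.

Lemma indivisible_or_cut zeta A : indivisible zeta A \/
  exists S, [/\ S \in F, zeta * #|A|%:R <= #|A :&: S|%:R
              & zeta * #|A|%:R <= #|A :\: S|%:R].
Proof.
have [/exists_inP [S SF /andP [leI leD]]|/exists_inPn /= noS] :=
    boolP [exists S in F, (zeta * #|A|%:R <= #|A :&: S|%:R) &&
                          (zeta * #|A|%:R <= #|A :\: S|%:R)].
  by right; exists S.
by left=> S /noS; rewrite negb_and -!ltNge => /orP.
Qed.

Lemma indivisible_superset eps zeta delta A W :
  0 <= eps -> zeta + delta <= eps ->
  W \subset A -> #|A :\: W|%:R <= delta * #|W|%:R ->
  indivisible zeta W -> indivisible eps A.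
Proof.
move=> eps0 le_eps sWA leD iW.
have small M : #|W :&: M|%:R < zeta * #|W|%:R ->
    #|A :&: M|%:R < eps * #|A|%:R.
  move=> ltM; have leA : (#|A :&: M| <= #|W :&: M| + #|A :\: W|)%N.
    rewrite -(cardsID W) leq_add ?subset_leq_card //.
      by rewrite setIAC setSI // subsetIr.
    by rewrite setSD // subsetIl.
  apply: (@lt_le_trans _ _ (eps * #|W|%:R)); last first.
    by rewrite ler_wpM2l // ler_nat subset_leq_card.
  have leW : (zeta + delta) * #|W|%:R <= eps * #|W|%:R by rewrite ler_wpM2r.
  by move: leA; rewrite -(ler_nat R) natrD; lra.
by move=> S /iW; rewrite !setDE => -[/small|/small]; [left | right].
Qed.

(* Splitting repeatedly, as long as it is possible, grows a full tree. *)
Lemma full_tree_or_indivisible zeta h A : 0 < zeta <= 1 -> A != set0 ->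
  full_tree (@mem_rel T) F h.+1 A \/
  exists A', [/\ A' \subset A, indivisible zeta A'
               & zeta ^+ h * #|A|%:R <= #|A'|%:R].
Proof.
move=> /andP [z0 z1] A0.
have large_neq0 (X Y : {set T}) :
    X != set0 -> zeta * #|X|%:R <= #|Y|%:R -> Y != set0.
  rewrite -!card_gt0 -!(ltr_nat R) => X0; apply: lt_le_trans.
  exact: mulr_gt0.
have zetaX_le d X : zeta ^+ d * #|X|%:R <= #|X|%:R.
  by rewrite ler_piMl // exprn_ile1 // ltW.
elim: h A A0 => [|h IH] A A0.
  have [iA|[S [SF leI leD]]] := indivisible_or_cut zeta A.
    by right; exists A.
  by left; exists S; split; rewrite ?lnbhd_mem //; apply: large_neq0 A0 _.
have [iA|[S [SF leI leD]]] := indivisible_or_cut zeta A.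
  by right; exists A.
have descend (B : {set T}) : zeta * #|A|%:R <= #|B|%:R ->
    zeta ^+ h.+1 * #|A|%:R <= zeta ^+ h * #|B|%:R.
  by move=> leB; rewrite exprSr -mulrA ler_wpM2l // exprn_ge0 // ltW.
have [tI|[A' [sA' iA' cA']]] := IH _ (large_neq0 _ _ A0 leI); last first.
  right; exists A'; rewrite (subset_trans sA') ?subsetIl //; split=> //.
  exact: le_trans (descend _ leI) cA'.
have [tD|[A' [sA' iA' cA']]] := IH _ (large_neq0 _ _ A0 leD); last first.
  right; exists A'; rewrite (subset_trans sA') ?subsetDl //; split=> //.
  exact: le_trans (descend _ leD) cA'.
by left; exists S; split; rewrite ?lnbhd_mem.
Qed.

End Indivisible.

(** * Sparse subsets *)

Section SparseSubsets.
Variables (R : realFieldType) (T I : finType) (G : {set I}) (M : I -> {set T}).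
Variables (A : {set T}) (rho : R).
Implicit Types (W : {set T}).

Lemma exp2_cards_setU1I (i : I) (x : T) W : x \notin W ->
  2 ^+ #|(x |: W) :&: M i| = 2 ^+ #|W :&: M i| * (1 + (x \in M i)%:R) :> R.
Proof.
move=> xW; rewrite setIUl; have [xM|xM] := boolP (x \in M i).
  by rewrite (setIidPl _) ?sub1set // cardsU1 inE (negbTE xW) exprSr.
by rewrite disjoint_setI0 ?disjoints1 // set0U addr0 mulr1.
Qed.

Definition exp2_moment W : R := \sum_(i in G) 2 ^+ #|W :&: M i|.

Lemma exp2_moment_setU1 W : W \proper A ->
  (forall i, i \in G -> #|A :&: M i|%:R <= rho * #|A :\: W|%:R) ->
  exists2 x, x \in A :\: W & exp2_moment (x |: W) <= exp2_moment W * (1 + rho).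
Proof.
move=> /properP [_ [x0 x0A x0W]] leM; apply: exists_le_mean.
  by apply/set0Pn; exists x0; rewrite inE x0W.
rewrite exchange_big -mulrA mulr_suml; apply: ler_sum => i iG.
under eq_bigr => x /setDP [_ xW] do rewrite exp2_cards_setU1I //.
rewrite -mulr_sumr ler_wpM2l ?exprn_ge0 // big_split /= sumr_const.
rewrite mulrDl mul1r lerD // -natr_sum -big_mkcondr /= sum1_card.
rewrite (le_trans _ (leM i iG)) // ler_nat.
apply/subset_leq_card/subsetP=> x.
by rewrite unfold_in => /andP [/setDP [xA _] xM]; rewrite inE xA.
Qed.

(* Derandomised choice of a random m-subset: each new element is chosen so that
   the exponential moment stays below its mean. *)
Lemma exists_subset_exp2_moment m : 0 <= rho -> (m <= #|A|)%N ->
  (forall i, i \in G -> #|A :&: M i|%:R <= rho * (#|A| - m)%:R) ->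
  exists W, [/\ W \subset A, #|W| = m
              & exp2_moment W <= #|G|%:R * (1 + rho) ^+ m].
Proof.
move=> rho0; elim: m => [|m IH] lem leM.
  exists set0; rewrite sub0set cards0 mulr1 /exp2_moment; split=> //.
  by under eq_bigr do rewrite set0I cards0 expr0; rewrite sumr_const.
have leM_mono p i : (p <= m.+1)%N -> i \in G ->
    #|A :&: M i|%:R <= rho * (#|A| - p)%:R.
  move=> lep iG; apply: le_trans (leM i iG) _; rewrite ler_wpM2l // ler_nat.
  exact: leq_sub2l.
have [i|W [sW cW bW]] := IH (ltnW lem); first by apply: leM_mono.
have cD : #|A :\: W| = (#|A| - m)%N by rewrite cardsD (setIidPr sW) cW.
have [|i|x xD bxW] := @exp2_moment_setU1 W.
- by rewrite properEcard sW cW.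
- by rewrite cD; apply: leM_mono.
exists (x |: W); split.
- by rewrite subUset sub1set sW andbT; case/setDP: xD.
- by rewrite cardsU1; case/setDP: xD => _ ->; rewrite cW.
- by rewrite (le_trans bxW) // exprSr mulrA ler_wpM2r // addr_ge0.
Qed.

End SparseSubsets.

Lemma exists_sparse_subset (R : realType) (T I : finType) (G : {set I})
    (M : I -> {set T}) (A : {set T}) (rho : R) m :
  0 < rho -> (m <= #|A|)%N ->
  (forall i, i \in G -> #|A :&: M i|%:R <= rho * (#|A| - m)%:R) ->
  #|G|%:R < (1 + rho) ^+ m ->
  exists W : {set T}, [/\ W \subset A, #|W| = m &
    forall i, i \in G -> #|W :&: M i|%:R < 4 * rho * m%:R].
Proof.
move=> rho0 lem leM ltG.
have [W [sW cW bW]] := exists_subset_exp2_moment (ltW rho0) lem leM.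
exists W; split=> // i iG; rewrite ltNge; apply/negP=> leW.
have e0 : 0 < (1 + rho) ^+ m by rewrite exprn_gt0 //; lra.
suff : (1 + rho) ^+ m * (1 + rho) ^+ m <= #|G|%:R * (1 + rho) ^+ m.
  by rewrite leNgt ltr_pM2r ?ltG.
apply: le_trans bW; apply: (@le_trans _ _ (2 ^+ #|W :&: M i|)).
  rewrite -exprD addnn -mul2n; apply: exp1D_le_exp2; first by lra.
  by apply: le_trans leW; rewrite natrM; lra.
rewrite /exp2_moment (bigD1 i) //= lerDl.
by apply: sumr_ge0 => j _; rewrite exprn_ge0.
Qed.

Lemma indivisible_subset (R : realType) (T : finType) (F : {set {set T}})
    (zeta : R) (A : {set T}) m :
  0 < zeta -> (m <= #|A|)%N -> #|F|%:R < (1 + 2 * zeta) ^+ m ->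
  indivisible F zeta A ->
  exists W : {set T}, [/\ W \subset A, #|W| = m & indivisible F (8 * zeta) W].
Proof.
move=> z0 lem fewF iA.
pose M S := if #|A :&: S|%:R < zeta * #|A|%:R then S else ~: S.
have leM S : S \in F -> #|A :&: M S|%:R < zeta * #|A|%:R.
  by move=> /iA; rewrite /M setDE; case: ifP => // _ [].
suff [W [sW cW leW]] : exists W : {set T}, [/\ W \subset A, #|W| = m &
    forall S, S \in F -> #|W :&: M S|%:R < 8 * zeta * m%:R].
  exists W; split=> // S /leW; rewrite cW /M.
  by case: ifP => _; [left | rewrite setDE; right].
have [leA|ltA] := leqP (2 * m) #|A|.
  have [||||W [sW cW leW]] :=
    @exists_sparse_subset R T _ F M A (2 * zeta) m => //.
  - by lra.
  - move=> S /leM /ltW leS; apply: le_trans leS _; rewrite -mulrA mulrCA.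
    by rewrite ler_wpM2l ?(ltW z0) // -natrM ler_nat; lia.
  by exists W; split=> // S /leW; rewrite mulrA -[4 * 2]natrM.
have [W sW cW] := exists_subset_card lem; exists W; split=> // S /leM ltM.
have leWA : #|W :&: M S|%:R <= #|A :&: M S|%:R :> R.
  by rewrite ler_nat subset_leq_card // setSI.
have leA2m : zeta * #|A|%:R <= zeta * (2 * m%:R).
  by rewrite ler_wpM2l ?(ltW z0) // -natrM ler_nat ltnW.
have : 0 <= zeta * m%:R by rewrite mulr_ge0 // ltW.
by lra.
Qed.

Lemma exists_indivisible_subset (R : realType) (T : finType) (F : {set {set T}})
    (zeta : R) h (X : {set T}) m :
  0 < zeta <= 1 -> X != set0 -> ~ full_tree (@mem_rel T) F h.+1 X ->
  m%:R <= zeta ^+ h * #|X|%:R -> #|F|%:R < (1 + 2 * zeta) ^+ m ->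
  exists W : {set T}, [/\ W \subset X, #|W| = m & indivisible F (8 * zeta) W].
Proof.
move=> z01 X0 noF lem fewF; have /andP [z0 _] := z01.
have [/noF //|[A [sAX iA cA]]] := full_tree_or_indivisible F h z01 X0.
have lemA : (m <= #|A|)%N by rewrite -(ler_nat R) (le_trans lem).
have [W [sWA cW iW]] := indivisible_subset z0 lemA fewF iA.
by exists W; rewrite (subset_trans sWA).
Qed.

(** * Equitable partitions *)

Definition equitable (T : finType) (P : {set {set T}}) : Prop :=
  forall A B, A \in P -> B \in P -> (#|A| <= #|B| + 1)%N.

Lemma greedy_packing (T : finType) (P : {set T} -> Prop) (large : pred nat) m :
  (0 < m)%N ->
  (forall X : {set T}, large #|X| ->
     exists W : {set T}, [/\ W \subset X, #|W| = m & P W]) ->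
  forall X : {set T}, exists Q : {set {set T}},
    [/\ trivIset Q, forall W, W \in Q -> #|W| = m /\ P W, cover Q \subset X
      & ~~ large #|X :\: cover Q|].
Proof.
move=> m0 pickW X; have [n] := ubnP #|X|; elim: n X => // n IH X.
rewrite ltnS => leX.
have [/pickW [W [sWX cW gW]]|small] := boolP (large #|X|); last first.
  exists set0; rewrite /cover big_set0 setD0 sub0set; split=> //.
    by apply/trivIsetP=> A B; rewrite inE.
  by move=> W; rewrite inE.
have [|Q [tQ hQ sQ smallQ]] := IH (X :\: W).
  have := subset_leq_card sWX.
  by rewrite cardsD (setIidPr sWX) cW; lia.
have [tWQ WQ] : trivIset (W |: Q) /\ W \notin Q.
  apply: trivIsetU1 tQ _ => [B BQ|].
    rewrite disjoint_sym disjoints_subset.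
    apply: subset_trans (bigcup_sup B BQ) _.
    by apply: subset_trans sQ _; rewrite setDE subsetIr.
  by apply/negP=> /hQ [/esym]; rewrite cards0; lia.
have coverWQ : cover (W |: Q) = W :|: cover Q by rewrite /cover big_setU1.
exists (W |: Q); rewrite coverWQ -setDDl; split=> //.
  by move=> A /setU1P [->|/hQ].
by rewrite subUset sWX (subset_trans sQ) // subsetDl.
Qed.

Lemma equitable_labelling (T I : finType) (Q : {set I}) (D : {set T}) :
  Q != set0 -> exists2 f : T -> I, (forall x, f x \in Q) &
    forall i j, i \in Q -> j \in Q ->
      (#|[set x in D | f x == i]| <= #|[set x in D | f x == j]| + 1)%N.
Proof.
case/set0Pn=> i0 i0Q; have [n] := ubnP #|D|; elim: n D => // n IH D.
rewrite ltnS => leD.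
have [->|/set0Pn [x xD]] := eqVneq D set0.
  by exists (fun=> i0) => // i j _ _; rewrite setIdE set0I cards0.
have [|f fQ eqf] := IH (D :\ x); first by move: leD; rewrite (cardsD1 x D) xD.
pose c i := #|[set y in D :\ x | f y == i]|.
have [imin iminQ lec] :
    exists2 i, i \in Q & forall j, j \in Q -> (c i <= c j)%N.
  by case: (arg_minnP c i0Q) => i iQ lec; exists i.
pose g y := if y == x then imin else f y.
have cg i : #|[set y in D | g y == i]| = ((imin == i) + c i)%N.
  rewrite (cardsD1 x) !inE xD /g eqxx /=; congr (_ + _)%N; apply: eq_card => y.
  by rewrite !inE; case: (y == x) => //=; rewrite andbT.
exists g => [y|i j iQ jQ]; first by rewrite /g; case: ifP.
rewrite !cg; have := eqf i j iQ jQ; rewrite -/(c i) -/(c j).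
have := lec j jQ; case: eqP => [<-|_] /=; lia.
Qed.

Section Absorption.
Variables (T : finType) (Q : {set {set T}}) (f : T -> {set T}).
Hypotheses (trivQ : trivIset Q) (fQ : forall x, f x \in Q).
Implicit Types (A W : {set T}).

Definition label x := if x \in cover Q then pblock Q x else f x.

Definition label_partition : {set {set T}} := preim_partition label [set: T].

Definition absorbed W : {set T} := [set x in ~: cover Q | f x == W].

Lemma sum_card_absorbed : (\sum_(W in Q) #|absorbed W|)%N = #|~: cover Q|.
Proof.
rewrite -sum1_card (partition_big f (mem Q)) //=.
by apply: eq_bigr => W _; rewrite sum1dep_card.
Qed.

Lemma label_fiber W : W \in Q -> [set x | label x == W] = W :|: absorbed W.
Proof.
move=> WQ; apply/setP=> x; rewrite !inE /label.
have [xC|xC] := boolP (x \in cover Q); rewrite /= ?orbF.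
  by apply/eqP/idP=> [<-|xW]; rewrite ?mem_pblock //; apply: def_pblock.
suff /negbTE -> : x \notin W by [].
by apply: contra xC => xW; apply/bigcupP; exists W.
Qed.

Lemma card_label_fiber W :
  W \in Q -> #|[set x | label x == W]| = (#|W| + #|absorbed W|)%N.
Proof.
move=> WQ; rewrite label_fiber //; apply: (@cardsU_sub _ (cover Q)).
  exact: bigcup_sup WQ.
by apply/subsetP=> x; rewrite inE => /andP [].
Qed.

Lemma label_partitionP A :
  A \in label_partition -> exists2 W, W \in Q & A = [set x | label x == W].
Proof.
case/imsetP=> x _ ->; exists (label x).
  by rewrite /label; case: ifP => // /pblock_mem.
by apply/setP=> y; rewrite !inE eq_sym.
Qed.

Lemma card_label_partition : (#|label_partition| <= #|Q|)%N.
Proof.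
pose fiber W := [set x | label x == W].
apply: leq_trans (leq_imset_card fiber Q); apply: subset_leq_card.
by apply/subsetP=> A /label_partitionP [W WQ ->]; apply: imset_f.
Qed.

End Absorption.

Lemma equitable_superpartition (T : finType) (Q : {set {set T}}) m :
  trivIset Q -> Q != set0 -> (forall W, W \in Q -> #|W| = m) ->
  exists P : {set {set T}},
    [/\ partition P [set: T], (#|P| <= #|Q|)%N, equitable P &
        forall A, A \in P -> exists W, [/\ W \in Q, W \subset A &
          (#|Q| * #|A :\: W| <= #|~: cover Q| + #|Q|)%N]].
Proof.
move=> trivQ Q0 cQ; have [f fQ eqf] := equitable_labelling (~: cover Q) Q0.
exists (label_partition Q f); split.
- exact: preim_partitionP.
- exact: card_label_partition.
- move=> A B /(label_partitionP fQ) [W WQ ->].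
  move=> /(label_partitionP fQ) [W' WQ' ->].
  by rewrite !card_label_fiber // (cQ _ WQ) (cQ _ WQ') -addnA leq_add2l eqf.
move=> A /(label_partitionP fQ) [W WQ ->]; exists W.
have sW : W \subset [set x | label Q f x == W].
  by rewrite label_fiber // subsetUl.
split=> //; rewrite cardsD (setIidPr sW) card_label_fiber // addKn.
rewrite -(sum_card_absorbed fQ) -[X in (_ <= _ + X)%N]sum1_card -big_split /=.
by rewrite -sum_nat_const; apply: leq_sum => W' WQ'; apply: eqf.
Qed.

Lemma equitable_indivisible_partition (R : realFieldType) (T : finType)
    (F : {set {set T}}) (eps zeta delta : R) m :
  0 <= zeta -> zeta + 3 * delta <= eps ->
  0 < delta <= 1 / 2 -> 1 <= delta * m%:R ->
  (forall X : {set T}, delta * #|T|%:R <= #|X|%:R ->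
     exists W : {set T}, [/\ W \subset X, #|W| = m & indivisible F zeta W]) ->
  exists P : {set {set T}},
    [/\ partition P [set: T], (#|P| * m <= #|T|)%N, equitable P &
        forall A, A \in P -> indivisible F eps A].
Proof.
move=> z0 le_eps /andP [d0 d2] dm pickW.
have m0 : (0 < m)%N by case: (m) dm => //; rewrite mulr0; lra.
have [Q [trivQ hQ _]] := greedy_packing
  (large := fun n => delta * #|T|%:R <= n%:R) m0 pickW [set: T].
rewrite setTD -ltNge => rest.
have cardQ : (#|Q| * m + #|~: cover Q|)%N = #|T|.
  rewrite -(cardsC (cover Q)) -(eqP trivQ) -sum_nat_const.
  by congr (_ + _)%N; apply: eq_bigr => W /hQ [->].
have cardQR : #|Q|%:R * m%:R + #|~: cover Q|%:R = #|T|%:R :> R.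
  by rewrite -cardQ natrD natrM.
have Q0 : Q != set0.
  apply: contraTneq rest => Q0; move: cardQR.
  by rewrite Q0 cards0 mul0r add0r -leNgt => ->; rewrite ler_piMl //; lra.
have [P [pP cP eP hP]] :=
  equitable_superpartition trivQ Q0 (fun W WQ => (hQ W WQ).1).
exists P; split=> // [|A /hP [W [/hQ [cW iW] sWA leD]]].
  by rewrite -cardQ (leq_trans _ (leq_addr _ _)) // leq_mul2r cP orbT.
apply: (@indivisible_superset _ _ _ eps zeta (3 * delta)) sWA _ iW => //.
  by lra.
have q0 : 0 < #|Q|%:R :> R by rewrite ltr0n card_gt0.
rewrite cW -(ler_pM2l q0); move: leD; rewrite -(ler_nat R) natrM natrD => leD.
have dT : delta * #|T|%:R <= delta * (2 * (#|Q|%:R * m%:R)).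
  have leT2 : delta * #|T|%:R <= 1 / 2 * #|T|%:R by rewrite ler_wpM2r.
  by rewrite ler_wpM2l ?(ltW d0) //; lra.
have qdm : #|Q|%:R * 1 <= #|Q|%:R * (delta * m%:R) by rewrite ler_pM2l.
by lra.
Qed.

(* The pieces have size close to [zeta ^ h.+1 * #|T|], where [zeta = eps / 16]:
   the subset on which the splitting of a set of size [zeta * #|T|] stops is at
   least that large. *)
Lemma tree_free_equitable_partition (R : realType) (eps : R) h : 0 < eps <= 1 ->
  exists n0 : nat, forall (T : finType) (F : {set {set T}}),
    (forall X, ~ full_tree (@mem_rel T) F h.+1 X) -> (n0 <= #|T|)%N ->
    exists P : {set {set T}},
      [/\ partition P [set: T], #|P|%:R <= 2 * (16 / eps) ^+ h.+1, equitable P &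
          forall A, A \in P -> indivisible F eps A].
Proof.
move=> /andP [e0 e1]; pose z := eps / 16; pose s := z ^+ h.+1.
have zE : 16 * z = eps by rewrite /z; field.
have z0 : 0 < z by lra.
have s0 : 0 < s by rewrite exprn_gt0.
pose D := half_graph_height (2 ^ h.+1).
have [n1 fewF] := @poly_lt_exp_truncn _ s (1 + 2 * z) D s0 ltac:(lra).
have [n2 large_m] := truncn_mulr_unbounded (Num.truncn z^-1).+1 s0.
exists (maxn n1 n2) => T F noF; rewrite geq_max => /andP [/fewF + /large_m].
set m := Num.truncn _ => ltF ltm.
have zm : 1 <= z * m%:R.
  rewrite -ler_pdivrMl // mulr1.
  by rewrite (le_trans (ltW (truncnS_gt _))) // ler_nat.
have mle : m%:R <= s * #|T|%:R by rewrite truncn_le // mulr_ge0 // ltW.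
have ltm1 : s * #|T|%:R < m%:R + 1 by rewrite natr1 truncnS_gt.
have m0 : 0 < m%:R :> R by rewrite ltr0n (leq_trans _ ltm).
have T0 : 0 < #|T|%:R :> R.
  by rewrite -(pmulr_rgt0 _ s0) (lt_le_trans m0).
have pickW (X : {set T}) : z * #|T|%:R <= #|X|%:R ->
    exists W : {set T}, [/\ W \subset X, #|W| = m & indivisible F (8 * z) W].
  move=> leX; apply: (@exists_indivisible_subset _ _ _ _ h) => //; first by lra.
  - by rewrite -card_gt0 -(ltr_nat R) (lt_le_trans _ leX) // mulr_gt0.
  - by rewrite (le_trans mle) // /s exprSr -mulrA ler_wpM2l ?exprn_ge0 // ltW.
  - by apply: le_lt_trans ltF; rewrite -natrX ler_nat card_no_full_tree.
have [|||P [pP cP eP iP]] :=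
  @equitable_indivisible_partition R T F eps (8 * z) z m _ _ _ zm pickW;
  try lra.
exists P; split=> //.
have -> : (16 / eps) ^+ h.+1 = s^-1 by rewrite /s /z -exprVn invf_div.
rewrite ler_pdivlMr // -(ler_pM2r m0).
have sT2 : s * #|T|%:R <= 2 * m%:R.
  have : 1 <= m%:R :> R by rewrite ler1n -(ltr0n R).
  by lra.
apply: le_trans sT2; rewrite mulrAC [s * _]mulrC ler_wpM2r ?(ltW s0) //.
by rewrite -natrM ler_nat.
Qed.

(** * Excellent sets *)

Section Excellent.
Variables (R : realType) (eps : R) (T : finType) (E : rel T).
Implicit Types (A B X S : {set T}).

(* The sets {a | t(a, B) = 1}. *)
Definition traces : {set {set T}} :=
  [set S : {set T} | [exists B : {set T},
     [forall a, all_but_few eps B (fun b => E a b == (a \in S))]]].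

Lemma tracesP S :
  reflect (exists B, forall a, truth_value eps E a B (a \in S)) (S \in traces).
Proof.
rewrite inE; apply: (iffP existsP) => -[B tB]; exists B; first exact/forallP.
exact/forallP.
Qed.

Lemma excellent_of_indivisible A :
  indivisible traces eps A -> excellent eps E A.
Proof.
move=> iA B _ t tB; have /iA : [set a | t a] \in traces.
  by apply/tracesP; exists B => a; rewrite inE.
rewrite setDE !setIdE.
have -> : [set a | t a == true] = [set a | t a].
  by apply/setP=> a; rewrite !inE eqb_id.
by have -> : [set a | t a == false] = ~: [set a | t a]
  by apply/setP=> a; rewrite !inE eqbF_neg.
Qed.

Lemma good_set1 b : 0 < eps -> good eps E [set b].
Proof.
move=> e0 x; rewrite !setIdE cards1 mulr1.
have [Exb|Exb] := boolP (E x b); [right | left];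
  by rewrite disjoint_setI0 ?cards0 // disjoints1 inE ?Exb // (negbTE Exb).
Qed.

Lemma excellent_good A :
  symmetric E -> 0 < eps -> excellent eps E A -> good eps E A.
Proof.
move=> symE e0 xA b; have tb a : truth_value eps E a [set b] (E a b).
  rewrite /truth_value /all_but_few setIdE.
  rewrite disjoint_setI0 ?cards0 ?cards1 ?mulr1 //.
  by rewrite disjoints1 inE eqxx.
have := xA _ (good_set1 b e0) _ tb; rewrite !setIdE.
have -> : [set a | E a b == true] = [set a | E b a].
  by apply/setP=> a; rewrite !inE eqb_id symE.
by have -> : [set a | E a b == false] = [set a | ~~ E b a]
  by apply/setP=> a; rewrite !inE eqbF_neg symE.
Qed.

Lemma good_truth_value B a : good eps E B ->
  truth_value eps E a B (all_but_few eps B (fun b => E a b == true)).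
Proof.
move=> gB; rewrite /truth_value.
case ta : (all_but_few _ _ (fun b => E a b == true)) => //; move: ta.
rewrite /all_but_few !setIdE.
have -> : [set b | ~~ (E a b == true)] = [set b | ~~ E a b].
  by apply/setP=> b; rewrite !inE eqb_id.
have -> : [set b | ~~ (E a b == false)] = [set b | E a b].
  by apply/setP=> b; rewrite !inE eqbF_neg negbK.
by case: (gB a); rewrite !setIdE => ->.
Qed.

Lemma excellent_uniform A B : symmetric E -> 0 < eps ->
  excellent eps E A -> excellent eps E B -> uniform eps E A B.
Proof.
move=> symE e0 xA /(excellent_good symE e0) gB.
pose t a := all_but_few eps B (fun b => E a b == true).
have tB a : truth_value eps E a B (t a) by apply: good_truth_value.
case: (xA B gB t tB) => ltA; [exists false | exists true];
  apply: le_lt_trans ltA; rewrite ler_nat; apply/subset_leq_card/subsetP=> a;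
  rewrite !inE => /andP [-> /=]; have := tB a; rewrite /truth_value;
  by case: (t a) => // ->.
Qed.

Lemma excellent_gt_half A : 1 / 2 < eps -> A != set0 -> excellent eps E A.
Proof.
move=> e2 A0; apply: excellent_of_indivisible => S _.
have : #|A|%:R = #|A :&: S|%:R + #|A :\: S|%:R :> R by rewrite -natrD cardsID.
have : 0 < #|A|%:R :> R by rewrite ltr0n card_gt0.
by case: (ltP #|A :&: S|%:R (eps * #|A|%:R)); [left | right; nra].
Qed.

(* If S = {a | t(a, B) = 1}, then a vertex b of B disagrees with S on at most
   eps * #|X| elements of X on average. *)
Lemma exists_vertex_tracing (x0 : T) S X : 0 <= eps -> S \in traces ->
  exists b X', [/\ X' \subset X, (1 - eps) * #|X|%:R <= #|X'|%:R &
    {in X', forall a, E a b = (a \in S)}].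
Proof.
move=> e0 /tracesP [B tB]; pose err b := [set a in X | E a b != (a \in S)].
have [||b _ le_err] :=
    @exists_le_mean R T B (fun b => #|err b|%:R) (eps * #|X|%:R).
- apply: contraTneq (tB x0) => ->.
  by rewrite /truth_value /all_but_few setIdE set0I cards0 mulr0 ltxx.
- rewrite -natr_sum sum_card_exchange natr_sum mulrAC mulr_natr -sumr_const.
  by apply: ler_sum => a _; apply/ltW/tB.
exists b, (X :\: err b); split; first exact: subsetDl.
  have := cardsID (err b) X.
  rewrite (setIidPr _); last by rewrite /err setIdE subsetIl.
  by move/(congr1 (fun n => n%:R : R)); rewrite natrD; lra.
by move=> a; rewrite !inE => /andP [+ aX]; rewrite aX negbK => /eqP.
Qed.

Lemma separating_tree_of_traces h X : (0 < #|T|)%N -> 0 <= eps <= 1 ->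
  separating_tree (@mem_rel T) traces h X ->
  exists X', [/\ X' \subset X, (1 - eps) ^+ h * #|X|%:R <= #|X'|%:R
               & separating_tree E [set: T] h X'].
Proof.
move=> /card_gt0P [x0 _] /andP [e0 e1]; elim: h X => [|h IH] X /=.
  by exists X; rewrite mul1r.
case=> S [/(exists_vertex_tracing x0 X e0) [b [X1 [sX1 cX1 Eb]]]].
rewrite lnbhd_mem => /(separating_treeS (setSI S sX1)) tI.
move=> /(separating_treeS (setSD S sX1)) tD.
have [[Y1 [sY1 cY1 tY1]] [Y2 [sY2 cY2 tY2]]] := (IH _ tI, IH _ tD).
have sN1 : Y1 \subset lnbhd E b.
  by apply/subsetP=> a /(subsetP sY1) /setIP [aX aS]; rewrite inE Eb.
have sN2 : Y2 \subset ~: lnbhd E b.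
  by apply/subsetP=> a /(subsetP sY2) /setDP [aX aS]; rewrite !inE Eb.
exists (Y1 :|: Y2); split; last by exists b; rewrite inE setIU_sub ?setDU_sub.
  rewrite subUset (subset_trans sY1) ?(subset_trans sY2) //.
    by rewrite (subset_trans (subsetDl _ _)).
  by rewrite (subset_trans (subsetIl _ _)).
rewrite (cardsU_sub sN1 sN2) natrD exprSr -mulrA.
apply: le_trans (lerD cY1 cY2).
by rewrite -mulrDr -natrD cardsID ler_wpM2l // exprn_ge0 //; lra.
Qed.

Lemma stable_no_trace_tree k h X :
  irreflexive E -> edge_stable k E -> 0 <= eps <= 1 ->
  (\sum_(i < half_graph_height k) 'C(h, i))%:R < (2 * (1 - eps)) ^+ h ->
  ~ full_tree (@mem_rel T) traces h X.
Proof.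
move=> irrE stE eps01 ltsum tX.
have T0 : (0 < #|T|)%N.
  by have /set0Pn [x _] := full_tree_neq0 tX; apply/card_gt0P; exists x.
have [X1 [_ cX1 /(separating_tree_of_traces T0 eps01) [X2 [_ cX2 sepX2]]]] :=
  full_tree_separating tX.
apply: (stable_no_full_tree irrE stE (full_tree_of_separating sepX2 _)).
rewrite -(ltr_nat R) (lt_le_trans ltsum) // (le_trans _ cX2) //.
by rewrite cX1 exprMn natrX mulrC.
Qed.

End Excellent.

(** * The height of trees of good sets *)

Lemma sum_bin_lt_exp (R : realDomainType) (eps : R) d : 0 <= eps <= 1 ->
  (d * 2 ^ d)%:R * eps < 1 ->
  (\sum_(i < d) 'C(d, i))%:R < (2 * (1 - eps)) ^+ d.
Proof.
move=> /andP [e0 e1]; rewrite natrM natrX => small.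
have sum_bin : (\sum_(i < d) 'C(d, i)).+1 = (2 ^ d)%N.
  rewrite -[2%N]/(1 + 1)%N expnDn big_ord_recr /= binn subnn !exp1n addn1.
  by congr _.+1; apply: eq_bigr => i _; rewrite !exp1n !muln1.
have -> : (\sum_(i < d) 'C(d, i))%:R = 2 ^+ d - 1 :> R.
  by rewrite -natrX -sum_bin -natr1 addrK.
have := @Bernoulli_le R (- eps) d; rewrite mulrN exprMn => /(_ ltac:(lra)) leB.
have : 2 ^+ d * (1 - d%:R * eps) <= 2 ^+ d * (1 - eps) ^+ d.
  by rewrite ler_wpM2l // exprn_ge0.
by lra.
Qed.

Lemma half_graph_height_tree_bound k : (1 <= k)%N ->
  (half_graph_height k * 2 ^ half_graph_height k <= 2 ^ tree_bound k)%N.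
Proof.
rewrite /half_graph_height /tree_bound expnD => k1; set K := (2 ^ k)%N.
have K2 : (2 <= K)%N by rewrite (@leq_pexp2l 2 1 k).
have -> : (K * 2 ^ 2 - 2 = K.+1 + (3 * K - 3))%N by lia.
rewrite expnD leq_mul2r; apply/orP; right.
have : (2 * K <= 2 ^ K)%N.
  by case: (K) K2 => [|j] // _; rewrite expnS leq_mul2l /= ltn_expl.
by rewrite expnS; lia.
Qed.

Lemma pieces_bound_le (R : realType) (eps : R) k : (1 <= k)%N -> 0 < eps <= 1 ->
  2 * (16 / eps) ^+ half_graph_height k <= 4 * (8 / eps) ^+ (tree_bound k - 2).
Proof.
move=> k1 /andP [e0 e1]; rewrite /half_graph_height /tree_bound expnD.
set K := (2 ^ k)%N; have K2 : (2 <= K)%N by rewrite (@leq_pexp2l 2 1 k).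
have -> : (3 * K - 3 = 3 * K.-1)%N by lia.
have -> : (K * 2 ^ 2 - 2 - 2 = 3 * K.-1 + K.-1)%N by lia.
have e8 : 8 <= 8 / eps by rewrite ler_pdivlMr //; nra.
have -> : 16 / eps = 2 * (8 / eps) by ring.
rewrite exprMn exprD exprM.
have le8 : (2 ^+ 3) ^+ K.-1 <= (8 / eps) ^+ K.-1.
  by rewrite lerXn2r ?nnegrE //; lra.
have w0 : 0 <= (8 / eps) ^+ (3 * K.-1) by rewrite exprn_ge0 //; lra.
have v0 : 0 <= (8 / eps) ^+ K.-1 by rewrite exprn_ge0 //; lra.
have := mulr_ge0 w0 v0; have := ler_wpM2l w0 le8; by lra.
Qed.

Lemma exists_tree_height (R : realType) (eps : R) (d : nat) :
  (0 < d)%N -> 0 < eps < 1 / 2 ->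
  exists h : nat,
    (\sum_(i < d) 'C(h.+1, i))%:R < (2 * (1 - eps)) ^+ h.+1 /\
    ((d * 2 ^ d)%:R * eps < 1 -> h.+1 = d).
Proof.
move=> d0 /andP [e0 e2]; have [small|large] := ltP ((d * 2 ^ d)%:R * eps) 1.
  exists d.-1; rewrite prednK //; split=> //.
  by apply: sum_bin_lt_exp => //; lra.
have [m0 hm0] := @poly_lt_exp R 1 (2 * (1 - eps)) d ler01 ltac:(lra).
exists m0; split=> //.
have := hm0 m0.+1 (leqnSn _); rewrite mul1r; apply: le_lt_trans.
by rewrite -natrX ler_nat leq_sum_bin_exp.
Qed.

Lemma stable_excellent_partition (R : realType) (k : nat) (eps : R) :
  (1 <= k)%N -> 0 < eps < 1 / 2 ->
  exists N n0 : nat,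
    (eps < 1 / 2 ^+ tree_bound k ->
       N%:R <= 4 * (8 / eps) ^+ (tree_bound k - 2)) /\
    forall (T : finType) (E : rel T),
      irreflexive E -> edge_stable k E -> (n0 <= #|T|)%N ->
      exists P : {set {set T}},
        [/\ partition P [set: T], (#|P| <= N)%N, equitable P
          & forall A, A \in P -> excellent eps E A].
Proof.
move=> k1 e02; have /andP [e0 e2] := e02; pose d := half_graph_height k.
have d0 : (0 < d)%N.
  by rewrite /d /half_graph_height; have := @leq_pexp2l 2 1 k isT k1; lia.
have [h [ltsum hd]] := exists_tree_height d0 e02.
have [n0 part] := @tree_free_equitable_partition R eps h ltac:(lra).
pose v := 2 * (16 / eps) ^+ h.+1.
have v0 : 0 <= v by rewrite mulr_ge0 // exprn_ge0 // divr_ge0 // ltW.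
exists (Num.truncn v), n0; split=> [small|T E irrE stE leT].
  apply: (@le_trans _ _ v); first by rewrite truncn_le.
  rewrite /v hd ?pieces_bound_le //; first by lra.
  apply: le_lt_trans (_ : (2 ^ tree_bound k)%:R * eps < 1).
    by rewrite ler_wpM2r ?(ltW e0) // ler_nat half_graph_height_tree_bound.
  by rewrite natrX mulrC -ltr_pdivlMr ?exprn_gt0.
have [|P [pP cP eP iP]] := part T (traces eps E) _ leT.
  by move=> X; apply: (stable_no_trace_tree irrE stE _ ltsum); lra.
exists P; split=> // [|A /iP]; first by rewrite truncn_ge_nat.
exact: excellent_of_indivisible.
Qed.

Lemma exp_tree_bound_le_half (R : realFieldType) k :
  1 / 2 ^+ tree_bound k <= 1 / 2 :> R.
Proof.
rewrite !div1r lef_pV2 ?posrE ?exprn_gt0 // -[leLHS]expr1 ler_weXn2l ?ler1n //.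
by rewrite /tree_bound expnD; have := expn_gt0 2 k; lia.
Qed.

Lemma excellent_partition_gt_half (R : realType) (eps : R) (T : finType)
    (E : rel T) :
  1 / 2 < eps -> (1 <= #|T|)%N ->
  exists P : {set {set T}},
    [/\ partition P [set: T], (#|P| <= 1)%N, equitable P
      & forall A, A \in P -> excellent eps E A].
Proof.
move=> e2 T0; have nzT : [set: T] != set0 by rewrite -card_gt0 cardsT.
exists [set [set: T]]; split.
- by rewrite /partition cover1 eqxx trivIset1 inE eq_sym.
- by rewrite cards1.
- by move=> A B /set1P -> /set1P ->; rewrite leq_addr.
- by move=> A /set1P ->; apply: excellent_gt_half.
Qed.

(* The single value eps = 1/2 is excluded because the claim is false there
   (already for k = 3): in the join of two perfect matchings on 2^j vertices
   each, no nonempty set of even size is 1/2-excellent, so an equitable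
   partition into 1/2-excellent pieces can only consist of singletons. *)
Theorem theorem1p15 (R : realType) (k : nat) (eps : R) :
  (1 <= k)%N -> 0 < eps -> eps <> 1 / 2 ->
  exists N n0 : nat,
    (eps < 1 / 2 ^+ tree_bound k ->
       N%:R <= 4 * (8 / eps) ^+ (tree_bound k - 2)) /\
    forall (T : finType) (E : rel T),
      symmetric E -> irreflexive E -> edge_stable k E -> (n0 <= #|T|)%N ->
      exists P : {set {set T}},
        [/\ partition P [set: T],
            (#|P| <= N)%N,
            forall A B, A \in P -> B \in P -> (#|A| <= #|B| + 1)%N,
            forall A, A \in P -> excellent eps E A &
            forall A B, A \in P -> B \in P -> uniform eps E A B].
Proof.
move=> k1 e0 ne2; have [lt2|gt2|//] := ltgtP eps (1 / 2); last first.
  exists 1, 1; split=> [small|T E symE _ _ T0].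
    by have := exp_tree_bound_le_half R k; lra.
  have [P [pP cP eP xP]] := excellent_partition_gt_half E gt2 T0.
  by exists P; split=> // A B /xP xA /xP xB; apply: excellent_uniform.
have [|N [n0 [leN part]]] := @stable_excellent_partition R k eps k1.
  by rewrite e0.
exists N, n0; split=> // T E symE irrE stE leT.
have [P [pP cP eP xP]] := part T E irrE stE leT.
by exists P; split=> // A B /xP xA /xP xB; apply: excellent_uniform.
Qed.
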